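(* Let $b\in(0,3)$ and let $u\in C([0,\infty);H^1(\mathbb{R}))\cap L^\infty([0,\infty);H^1(\mathbb{R}))$ be a global solution of the $b$-family equation $$\partial_t u+\partial_x\left(\tfrac12 u^2+G\left(\tfrac b2u^2+\tfrac{3-b}{2}(\partial_xu)^2\right)\right)=0 .$$ Then $$\liminf_{t\to\infty}\|u(t)\|_{H^1(\Lambda_{2/3}(t))}=0 .$$
   Context: $G=(1-\partial_x^2)^{-1}$, i.e. $Gf=\frac12 e^{-|x|}*f$ on $\mathbb{R}$. The equation is posed for $x\in\mathbb{R}$, $t\ge 0$, and is understood in the weak (distributional) sense. For $c>0$ and $t>1$, $$\Lambda_c(t)=\left(-\frac{t^c}{\log t},\ \frac{t^c}{\log t}\right),$$ and for an interval $\Lambda$, $\|u\|_{H^1(\Lambda)}^2=\int_\Lambda (u^2+(\partial_xu)^2)\,dx$. *)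

(* Defs.v *)
From mathcomp Require Export all_boot all_order all_algebra.
From mathcomp Require Export all_classical all_reals all_analysis.

Set Implicit Arguments.
Unset Strict Implicit.
Unset Printing Implicit Defensive.

Export Order.TTheory GRing.Theory Num.Theory.
Export numFieldNormedType.Exports.

Open Scope classical_set_scope.
Open Scope ring_scope.

(* All iterated directional derivatives exist and are continuous.  On the
   finite-dimensional spaces R and R * R used below, this is C^infinity. *)
Definition smooth (R : realType) (V : normedModType R) (f : V -> R^o) : Prop :=
  forall s : seq V,
    let g := foldr (fun v h => 'D_v h) f s in
    continuous g /\ forall x v, derivable g x v.

Definition test_function (R : realType) (V : normedModType R) (O : set V)
    (phi : V -> R^o) : Prop :=
  let supp := closure [set x | phi x != 0] in
  [/\ smooth phi, compact supp & supp `<=` O].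

Section Sobolev.
Variable R : realType.
Let mu : {measure set (measurableTypeR R) -> \bar R} := @lebesgue_measure R.

Definition is_weak_derivative (f g : R -> R) : Prop :=
  [/\ locally_integrable [set: R] f, locally_integrable [set: R] g &
    forall phi : R^o -> R^o, test_function [set: R^o] phi ->
      \int[mu]_x (f x * 'D_1 phi x) = - \int[mu]_x (g x * phi x)].

(* A chosen representative; it is unique up to equality almost everywhere, and
   everything below depends on it only through integrals in x. *)
Definition weak_derivative (f : R -> R) : R -> R :=
  get [set g : R -> R | is_weak_derivative f g].

(* Membership of a representative f : R -> R in H^1(R). *)
Definition H1 (f : R -> R) : Prop :=
  f \in Lfun mu 2%:E /\
  exists g, is_weak_derivative f g /\ g \in Lfun mu 2%:E.

Definition H1_norm (A : set R) (f : R -> R) : \bar R :=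
  sqrte (\int[mu]_(x in A) (f x ^+ 2 + weak_derivative f x ^+ 2)%:E)%E.

(* G = (1 - d^2/dx^2)^-1, as convolution with exp(-|x|) / 2. *)
Definition G_op (f : R -> R) (x : R) : R :=
  2^-1 * \int[mu]_y (expR (- `|x - y|) * f y).

Definition b_flux (b : R) (f : R -> R) (x : R) : R :=
  2^-1 * f x ^+ 2 +
  G_op (fun y => b / 2 * f y ^+ 2 + (3 - b) / 2 * weak_derivative f y ^+ 2) x.

Definition continuous_in_H1 (u : R -> R -> R) : Prop :=
  (forall t, 0 <= t -> H1 (u t)) /\
  (forall t, 0 <= t ->
     H1_norm [set: R] (fun x => u s x - u t x)
       @[s --> within `[0, +oo[ (nbhs t)] --> 0%E).

Definition ess_bounded_in_H1 (u : R -> R -> R) : Prop :=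
  exists M : R,
    {ae mu, forall t, 0 <= t -> (H1_norm [set: R] (u t) <= M%:E)%E}.

(* The distributional equation on (0, oo) x R, a point of R * R being (t, x).
   The integral is iterated because the representatives u t and
   weak_derivative (u t) are chosen separately for each t, so need not be jointly
   measurable; for u continuous in H^1 the inner integral is continuous in t. *)
Definition b_family_weak_solution (b : R) (u : R -> R -> R) : Prop :=
  forall phi : (R^o * R^o)%type -> R^o,
    test_function [set p : R^o * R^o | 0 < p.1] phi ->
    \int[mu]_(t in `]0, +oo[)
      (\int[mu]_x (u t x * 'D_(1, 0) phi (t, x) +
                   b_flux b (u t) x * 'D_(0, 1) phi (t, x))) = 0.

Definition Lambda (c t : R) : set R :=
  `](- (t `^ c / ln t)), (t `^ c / ln t)[.

End Sobolev.

(* Main.v *)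
(* Test the equation against theta(t) Phi(x), where Phi increases with slope of
   order 1/lam on (-lam, lam), decays at the larger scale eta, and is bounded,
   and theta is a bump on [T, 2T].  The flux F = u^2/2 + G(...) is nonnegative,
   has bounded integral over R, and, since G has a positive kernel, its integral
   over (-lam, lam) dominates a fixed multiple of the square of the local H^1
   norm.  As |int u Phi| = O(eta^(1/2)), the equation bounds
   T/lam * inf_{[T, 2T]} |u|_{H^1(-lam, lam)}^2 by O(eta^(1/2) + T/eta).  With
   eta = T^(2/3) and lam of order T^(2/3) / log T this forces the infimum to be
   O(1/log T). *)

From mathcomp Require Import ring lra measurable_realfun.
Require Import Defs.

Set Implicit Arguments.
Unset Strict Implicit.

(** * A smooth test function *)

(** The losses [eta^(1/2)] and [T/eta] balance exactly at [eta = T^(2/3)], where both are of order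
    [T^(1/3)]. There the gain [T/lam] beats them only by the factor [eta/lam], so the logarithm in
    the definition of [Lambda] is what decides the comparison. Writing [T = s^3] and [eta = s^2]
    keeps fractional powers out of everything except [Lambda] itself. The inner integral need not be
    measurable in [t], and a real-valued integral that diverges takes the value 0 by convention. The
    hypothesis that the tested integral is 0 therefore says something only once that integral is
    known to be finite. This is why each estimate from below travels with a crude estimate from
    above. *)

Section Bump.
Variable R : realType.
Implicit Types (y : R) (n : nat).

(** The powers of [y] in the denominator make the family stable under differentiation up to linear
    combinations. The cutoffs use [bump 0], whose derivative is [bump 2]. *)
Definition bump n y : R := if 0 < y then expR (- y^-1) / y ^+ n else 0.

Lemma bump_ge0 n y : 0 <= bump n y.
Proof.
rewrite /bump; case: ifP => // y0.
by rewrite divr_ge0 ?expR_ge0// exprn_ge0// ltW.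
Qed.

Lemma bump_le0 n y : y <= 0 -> bump n y = 0.
Proof. by rewrite /bump ltNge => ->. Qed.

Lemma bump_gt0 n y : 0 < y -> 0 < bump n y.
Proof. by move=> y0; rewrite /bump y0 divr_gt0 ?expR_gt0// exprn_gt0. Qed.

(** One term of the exponential series gives [exp(1/y) >= y^-(n+2) / (n+2)!]. A quadratic bound is
    what makes the derivative at the junction point 0 exist and vanish. *)
Lemma bump_quad n y : bump n y <= (n.+2)`!%:R * y ^+ 2.
Proof.
rewrite /bump; case: ifP => y0; last by rewrite mulr_ge0// sqr_ge0.
have iy : 0 <= y^-1 by rewrite invr_ge0 ltW.
have := expR_ge1Dxn n.+1 iy.
rewrite expRN => h.
rewrite ler_pdivrMr ?exprn_gt0// -mulrA -exprD.
rewrite -[leRHS]invrK lef_pV2 ?posrE ?expR_gt0//; last first.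
  by rewrite invr_gt0 mulr_gt0 ?ltr0n ?fact_gt0// exprn_gt0.
apply: le_trans h; rewrite invfM mulrC -exprVn addnC addn2.
by rewrite lerDr.
Qed.

Lemma is_derive_bump n y :
  is_derive y 1 (bump n) (bump n.+2 y - n%:R * bump n.+1 y).
Proof.
have [y0|y0|->] := ltgtP y 0.
- rewrite !bump_le0 ?ltW// mulr0 subr0.
  apply: (@near_eq_is_derive _ _ _ (cst 0)).
  by near=> z; rewrite bump_le0//; apply: ltW; near: z; exact: lt_nbhsl.
- have yn0 : y != 0 by rewrite gt_eqF.
  have -> : bump n.+2 y - n%:R * bump n.+1 y =
      expR (- y^-1) / y ^+ n.+2 - n%:R * (expR (- y^-1) / y ^+ n.+1).
    by rewrite /bump y0.
  apply: (@near_eq_is_derive R R R (fun z : R => expR (- z^-1) * (z ^+ n)^-1)).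
    by near=> z; rewrite /bump ifT//; near: z; exact: lt_nbhsr.
  have dI : is_derive y 1 (fun z : R => z^-1) (- y ^- 2 *: 1).
    exact: (@is_deriveV _ id).
  have dE : is_derive y 1 (fun z : R => expR (- z^-1)) (expR (- y^-1) * - (- y ^- 2 *: 1)).
    by apply: is_derive1_comp.
  have dX : is_derive y 1 (fun z : R => (z ^+ n)^-1) (- (y ^+ n) ^- 2 *: ((n%:R * y ^+ n.-1) *: 1)).
    apply: is_deriveV; first by rewrite expf_neq0.
    suff -> : (fun z : R => z ^+ n) = (id : R -> R) ^+ n by exact: is_deriveX.
    by apply/funext => z; rewrite exprfctE.
  apply: is_derive_eq.
  rewrite /GRing.scale /=.
  (* The case [n = 0] is separate because [n.-1] truncates there. *)
  case: n {dX} => [|n] /=; first by rewrite !expr0 expr1; field.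
  by rewrite !exprS; field; rewrite expf_neq0.
- rewrite !bump_le0// mulr0 subr0.
  suff H : h^-1 *: ((bump n \o shift 0) (h *: 1) - bump n 0) @[h --> 0^'] --> (0:R).
    by split; [apply/cvg_ex; exists 0 | exact/cvg_lim].
  apply: (@cvg_to_0_linear _ _ (n.+2)`!%:R 1) => // h /andP[h0 _].
  rewrite /= addr0 (bump_le0 _ (lexx 0)) subr0 /GRing.scale /= mulr1.
  rewrite normrM normfV ler_pdivrMl// ger0_norm ?bump_ge0//.
  by rewrite (le_trans (bump_quad _ _))// -(real_normK (num_real h)) expr2 mulrCA.
Unshelve. all: by end_near. Qed.

Lemma continuous_bump n : continuous (bump n).
Proof.
move=> y; apply: differentiable_continuous; apply/derivable1_diffP.
exact: (@ex_derive _ _ _ _ _ _ _ (is_derive_bump n y)).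
Qed.

Lemma bump0_lt1 y : bump 0 y <= 1.
Proof.
rewrite /bump; case: ifP => // y0.
by rewrite expr0 divr1 -expR0 ler_expR oppr_le0 invr_ge0 ltW.
Qed.

(** [dl] is the linear part of [l]; the identity is stated at [h *: v + x], the point that occurs in
    the difference quotient along [v]. *)
Definition affine (V : normedModType R) (l : V -> R) (dl : V -> R) :=
  continuous l /\ forall x v (h : R), l (h *: v + x) = h * dl v + l x.

Lemma is_derive_bump_affine (V : normedModType R) (l dl : V -> R) n (x v : V) :
  affine l dl -> is_derive x v (bump n \o l)
    ((bump n.+2 (l x) - n%:R * bump n.+1 (l x)) * dl v).
Proof.
move=> [_ lE].
(* On the line through [x] in direction [v] the function is [bump n \o g], so the one-variable chain
   rule at 0 suffices. *)
pose g (h : R) := h * dl v + l x.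
have dg : is_derive (0 : R) 1 g (dl v).
  have -> : g = dl v \*: (id : R -> R) + cst (l x).
    by apply/funext => h; rewrite /g mulrC.
  by apply: is_derive_eq; rewrite addr0 /GRing.scale /= mulr1.
have g0 : g 0 = l x by rewrite /g mul0r add0r.
have dc : is_derive (0 : R) 1 (bump n \o g)
    ((bump n.+2 (l x) - n%:R * bump n.+1 (l x)) * dl v).
  by apply: is_derive1_comp; rewrite g0; exact: is_derive_bump.
have e : (fun h : R => (bump n \o l) (h *: v + x)) = bump n \o g.
  by apply/funext => h /=; rewrite lE.
split.
  by apply/derivable1P; rewrite e; case: dc.
rewrite -(@derive_val _ _ _ _ _ _ _ dc) /derive.
set F1 := (X in lim (X @ _) = _); set F2 := (X in _ = lim (X @ _)).
suff -> : F1 = F2 by [].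
apply/funext => h; rewrite /F1 /F2 /= lE addr0 /g mul0r add0r.
by rewrite /GRing.scale /= mulr1.
Qed.

(* The algebra generated by the [bump n \o l] is stable under directional
   derivatives, so its elements are smooth. *)
Inductive bump_alg (V : normedModType R) : (V -> R) -> Prop :=
| bump_alg_base n l dl : affine l dl -> bump_alg (bump n \o l)
| bump_alg_cst (c : R) : bump_alg (fun=> c)
| bump_alg_add f g : bump_alg f -> bump_alg g -> bump_alg (f + g)
| bump_alg_mul f g : bump_alg f -> bump_alg g -> bump_alg (f * g).

Lemma bump_alg_continuous (V : normedModType R) (f : V -> R) :
  bump_alg f -> continuous f.
Proof.
elim=> {f} [n l dl [cl _]|c|f g _ cf _ cg|f g _ cf _ cg] x.
- by apply: continuous_comp; [exact: cl|exact: continuous_bump].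
- exact: cst_continuous.
- by apply: continuousD; [exact: cf|exact: cg].
- by apply: continuousM; [exact: cf|exact: cg].
Qed.

Lemma bump_alg_derive (V : normedModType R) (f : V -> R) (v : V) :
  bump_alg f ->
  exists2 df, bump_alg df & forall x, is_derive x v f (df x).
Proof.
elim=> {f} [n l dl al|c|f g af [df adf Hf] ag [dg adg Hg]|
            f g af [df adf Hf] ag [dg adg Hg]].
- exists ((bump n.+2 \o l + (fun=> - n%:R) * (bump n.+1 \o l)) * (fun=> dl v)).
    apply: bump_alg_mul; last exact: bump_alg_cst.
    apply: bump_alg_add; first exact: bump_alg_base al.
    apply: bump_alg_mul; first exact: bump_alg_cst.
    exact: bump_alg_base al.
  move=> x; apply: is_derive_eq; first exact: (is_derive_bump_affine n x v al).
  by rewrite !fctE mulNr.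
- by exists (fun=> 0) => [|x]; [exact: bump_alg_cst | exact: is_derive_cst].
- exists (df + dg) => [|x]; first exact: bump_alg_add.
  exact: is_deriveD.
- exists (f * dg + g * df) => [|x].
    by apply: bump_alg_add; exact: bump_alg_mul.
  exact: is_deriveM.
Qed.

Lemma bump_alg_smooth (V : normedModType R) (f : V -> R^o) :
  bump_alg f -> smooth f.
Proof.
move=> af s /=.
suff ag : bump_alg (foldr (fun v h => 'D_v h) f s).
  split; first exact: bump_alg_continuous.
  move=> x v; by have [dg _ /(_ x)[]] := bump_alg_derive v ag.
elim: s => //= v s /(bump_alg_derive v)[dg adg Hg].
suff -> : 'D_v (foldr (fun v h => 'D_v h) f s) = dg by [].
by apply/funext => x; case: (Hg x).
Qed.

End Bump.

(** * Cutoffs in time and space, and their product *)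

Section Cutoffs.
Variable R : realType.
Implicit Types (T eta lam t x y : R).

(** As [bump 2] is the derivative of [bump 0], this controls all slopes of the cutoffs. The constant
    is the [2!] of the quadratic term of the exponential series. *)
Lemma bump2_le2 y : bump 2 y <= 2.
Proof.
rewrite /bump; case: ifP => // y0.
have iy : 0 <= y^-1 by rewrite invr_ge0 ltW.
have := expR_ge1Dxn 1 iy; rewrite expRN => h.
rewrite ler_pdivrMr ?exprn_gt0// -[leRHS]invrK.
rewrite lef_pV2 ?posrE ?expR_gt0 ?invr_gt0 ?mulr_gt0 ?exprn_gt0//.
apply: le_trans h; rewrite invfM mulrC -exprVn.
by rewrite (_ : 2`! = 2)%N// lerDr.
Qed.

Lemma bump0_le y z : y <= z -> bump 0 y <= bump 0 z.
Proof.
move=> yz; have [y0|y0] := leP y 0; first by rewrite (bump_le0 _ y0) bump_ge0.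
have z0 := lt_le_trans y0 yz.
by rewrite /bump y0 z0 !expr0 !divr1 ler_expR lerN2 lef_pV2.
Qed.

(** [[1, 3]] is the range of [2 + x / lam] for [|x| <= lam], and 9 is the largest value of [y^2] on
    it. *)
Lemma bump2_ge y : 1 <= y <= 3 -> bump 0 1 / 9 <= bump 2 y.
Proof.
move=> /andP[y1 y3]; have y0 : 0 < y by apply: lt_le_trans y1.
have -> : bump 2 y = bump 0 y / y ^+ 2 by rewrite /bump y0 expr0 divr1.
rewrite ler_pM ?bump_ge0 ?invr_ge0 ?bump0_le//.
rewrite lef_pV2 ?posrE ?exprn_gt0//.
by rewrite (_ : 9 = 3 ^+ 2 :> R) ?ler_sqr ?nnegrE ?(ltW y0)//; ring.
Qed.

Definition theta T t : R := bump 0 (t / T - 1) * bump 0 (2 - t / T).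
Definition dtheta T t : R := T^-1 *
  (bump 2 (t / T - 1) * bump 0 (2 - t / T)
   - bump 0 (t / T - 1) * bump 2 (2 - t / T)).

(** The first factor is an increasing step starting at [-2 lam]; the shift by 2 keeps the core
    [(-lam, lam)] away from the flat start of [bump]. The other two cut off at [-2 eta] and [2 eta].
    In [dPhi] the [lam] term is accordingly nonnegative, and only the [eta] term can be negative. *)
Definition Phi lam eta x : R :=
  bump 0 (2 + x / lam) * (bump 0 (2 + x / eta) * bump 0 (2 - x / eta)).
Definition dPhi lam eta x : R :=
  lam^-1 * (bump 2 (2 + x / lam) * (bump 0 (2 + x / eta) * bump 0 (2 - x / eta)))
  + eta^-1 * (bump 0 (2 + x / lam) *
     (bump 2 (2 + x / eta) * bump 0 (2 - x / eta)
      - bump 0 (2 + x / eta) * bump 2 (2 - x / eta))).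

Lemma bump0_01 y : 0 <= bump 0 y <= 1.
Proof. by rewrite bump_ge0 bump0_lt1. Qed.

(** Both products lie in [[0, 2]], hence 2 and not the 4 of the triangle inequality. *)
Lemma bump_diff_le y z : `|bump 2 y * bump 0 z - bump 0 y * bump 2 z| <= 2.
Proof.
have := bump0_01 y; have := bump0_01 z.
have := bump2_le2 y; have := bump2_le2 z; have := bump_ge0 2 y; have := bump_ge0 2 z.
move=> ? ? ? ? /andP[? ?] /andP[? ?].
by rewrite ler_norml; apply/andP; split; nra.
Qed.

Lemma theta_ge0 T t : 0 <= theta T t.
Proof. by rewrite mulr_ge0 ?bump_ge0. Qed.

Lemma theta_le1 T t : theta T t <= 1.
Proof. by rewrite mulr_ile1 ?bump_ge0 ?bump0_lt1. Qed.

Lemma bump_pair_out m n T t : 0 < T -> ~ (T <= t <= 2 * T) ->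
  bump m (t / T - 1) * bump n (2 - t / T) = 0.
Proof.
move=> T0 /negP; rewrite negb_and -!ltNge => /orP[h|h].
  by rewrite bump_le0 ?mul0r// subr_le0 ler_pdivrMr// mul1r ltW.
by rewrite (bump_le0 n) ?mulr0// subr_le0 ler_pdivlMr// ltW.
Qed.

Lemma theta_out T t : 0 < T -> ~ (T <= t <= 2 * T) -> theta T t = 0.
Proof. by move=> *; apply: bump_pair_out. Qed.

Lemma dtheta_out T t : 0 < T -> ~ (T <= t <= 2 * T) -> dtheta T t = 0.
Proof. by move=> *; rewrite /dtheta !bump_pair_out// subrr mulr0. Qed.

Lemma dtheta_le T t : 0 < T -> `|dtheta T t| <= 2 / T.
Proof.
move=> T0; rewrite normrM ger0_norm ?invr_ge0 ?(ltW T0)// mulrC.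
by rewrite ler_pM2r ?invr_gt0// bump_diff_le.
Qed.

(** On the middle half of [[T, 2T]] both arguments of [bump 0] are at least 1/4. *)
Lemma theta_ge T t : 0 < T -> 5 / 4 * T <= t <= 7 / 4 * T ->
  bump 0 (4^-1) ^+ 2 <= theta T t.
Proof.
move=> T0 /andP[h1 h2].
have h3 : 5 / 4 <= t / T by rewrite ler_pdivlMr.
have h4 : t / T <= 7 / 4 by rewrite ler_pdivrMr.
by rewrite expr2 ler_pM ?bump_ge0 ?bump0_le//; lra.
Qed.

Lemma bump_pair_out' m n eta x : 0 < eta -> 2 * eta <= `|x| ->
  bump m (2 + x / eta) * bump n (2 - x / eta) = 0.
Proof.
move=> e0; rewrite ler_normr => /orP[h|h].
  by rewrite (bump_le0 n) ?mulr0// subr_le0 ler_pdivlMr.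
by rewrite bump_le0 ?mul0r// -lerBrDl sub0r ler_pdivrMr// mulNr lerNr.
Qed.

Lemma Phi_out lam eta x : 0 < eta -> 2 * eta <= `|x| -> Phi lam eta x = 0.
Proof. by move=> *; rewrite /Phi bump_pair_out'// mulr0. Qed.

Lemma Phi_ge0 lam eta x : 0 <= Phi lam eta x.
Proof. by rewrite !mulr_ge0 ?bump_ge0. Qed.

Lemma Phi_le1 lam eta x : Phi lam eta x <= 1.
Proof. by rewrite !mulr_ile1 ?mulr_ge0 ?bump_ge0 ?bump0_lt1. Qed.

Lemma dPhi_tail_le lam eta x : 0 < eta ->
  `|eta^-1 * (bump 0 (2 + x / lam) *
     (bump 2 (2 + x / eta) * bump 0 (2 - x / eta)
      - bump 0 (2 + x / eta) * bump 2 (2 - x / eta)))| <= 2 / eta.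
Proof.
move=> e0; rewrite normrM ger0_norm ?invr_ge0 ?(ltW e0)// mulrC.
rewrite ler_pM2r ?invr_gt0// normrM ger0_norm ?bump_ge0//.
by rewrite -[leRHS]mul1r ler_pM ?bump_ge0 ?bump0_lt1 ?bump_diff_le.
Qed.

Lemma dPhi_le lam eta x : 0 < lam -> 0 < eta ->
  `|dPhi lam eta x| <= 2 / lam + 2 / eta.
Proof.
move=> l0 e0; rewrite (le_trans (ler_normD _ _))// lerD ?dPhi_tail_le//.
rewrite normrM ger0_norm ?invr_ge0 ?(ltW l0)// mulrC ler_pM2r ?invr_gt0//.
rewrite ger0_norm ?mulr_ge0 ?bump_ge0// -[leRHS]mulr1.
by rewrite ler_pM ?mulr_ge0 ?mulr_ile1 ?bump_ge0 ?bump2_le2 ?bump0_lt1.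
Qed.

Lemma dPhi_ge lam eta x : 0 < lam -> 0 < eta -> - (2 / eta) <= dPhi lam eta x.
Proof.
move=> l0 e0; have := dPhi_tail_le lam x e0; rewrite ler_norml => /andP[h _].
rewrite /dPhi -[leLHS]add0r lerD// mulr_ge0 ?invr_ge0 ?(ltW l0)//.
by rewrite !mulr_ge0 ?bump_ge0.
Qed.

(** The step contributes [bump 2 >= bump 0 1 / 9]. Each outer cutoff contributes [bump 0 1], since
    [lam <= eta] keeps [2 + x / eta] and [2 - x / eta] above 1. *)
Lemma dPhi_core lam eta x : 0 < lam -> lam <= eta -> `|x| < lam ->
  bump 0 1 ^+ 3 / 9 / lam - 2 / eta <= dPhi lam eta x.
Proof.
move=> l0 le xl; have e0 := lt_le_trans l0 le.
have := dPhi_tail_le lam x e0; rewrite ler_norml => /andP[h _].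
rewrite /dPhi lerD// mulrC ler_pM2l ?invr_gt0//.
have H m : lam <= m -> -1 <= x / m <= 1.
  move=> lm; have m0 := lt_le_trans l0 lm.
  rewrite ler_pdivlMr// ler_pdivrMr// mulN1r mul1r -ler_norml.
  by rewrite (le_trans (ltW xl)).
have /andP[? ?] := H _ (lexx _); have /andP[? ?] := H _ le.
have -> : bump 0 1 ^+ 3 / 9 = bump 0 1 / 9 * (bump 0 1 * bump 0 1) :> R by ring.
rewrite !ler_pM ?mulr_ge0 ?bump_ge0 ?invr_ge0 ?bump0_le//; try lra.
by apply: bump2_ge; lra.
Qed.

Lemma affine_fst (a c : R) :
  affine (fun p : (R^o * R^o)%type => c + p.1 / a) (fun v => v.1 / a).
Proof.
split=> [p|p v h].
  apply: (@cvgD _ R^o); first exact: cvg_cst.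
  by apply: (@cvgM R); [exact: cvg_fst | exact: cvg_cst].
by rewrite /GRing.scale /= /GRing.scale /=; ring.
Qed.

Lemma affine_snd (a c : R) :
  affine (fun p : (R^o * R^o)%type => c + p.2 / a) (fun v => v.2 / a).
Proof.
split=> [p|p v h].
  apply: (@cvgD _ R^o); first exact: cvg_cst.
  by apply: (@cvgM R); [exact: cvg_snd | exact: cvg_cst].
by rewrite /GRing.scale /= /GRing.scale /=; ring.
Qed.

Definition testf T lam eta (p : (R^o * R^o)%type) : R^o :=
  theta T p.1 * Phi lam eta p.2.

(** A product of five generators of the algebra; the negative denominators put [2 - t / T] and
    [2 - x / eta] in the form [c + p / a]. *)
Lemma testfE T lam eta : testf T lam eta =
  ((bump 0 \o fun p => -1 + p.1 / T) * (bump 0 \o fun p => 2 + p.1 / - T)) *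
  ((bump 0 \o fun p => 2 + p.2 / lam) *
    ((bump 0 \o fun p => 2 + p.2 / eta) * (bump 0 \o fun p => 2 + p.2 / - eta))).
Proof.
by apply/funext => p; rewrite !fctE /testf /theta /Phi /= addrC !invrN !mulrN.
Qed.

Lemma testf_alg T lam eta : bump_alg (testf T lam eta).
Proof.
rewrite testfE; repeat apply: bump_alg_mul.
- exact: bump_alg_base (affine_fst T (-1)).
- exact: bump_alg_base (affine_fst (- T) 2).
- exact: bump_alg_base (affine_snd lam 2).
- exact: bump_alg_base (affine_snd eta 2).
- exact: bump_alg_base (affine_snd (- eta) 2).
Qed.

(** Here the explicit formulas [dtheta] and [dPhi] are identified as derivatives of [theta] and
    [Phi]. *)
Lemma derive_testf T lam eta (v p : (R^o * R^o)%type) :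
  'D_v (testf T lam eta) p =
  v.1 * (dtheta T p.1 * Phi lam eta p.2) + v.2 * (theta T p.1 * dPhi lam eta p.2).
Proof.
rewrite testfE.
have D1 := is_derive_bump_affine 0 p v (affine_fst T (-1)).
have D2 := is_derive_bump_affine 0 p v (affine_fst (- T) 2).
have D3 := is_derive_bump_affine 0 p v (affine_snd lam 2).
have D4 := is_derive_bump_affine 0 p v (affine_snd eta 2).
have D5 := is_derive_bump_affine 0 p v (affine_snd (- eta) 2).
have [_ ->] := is_deriveM (is_deriveM D1 D2) (is_deriveM D3 (is_deriveM D4 D5)).
rewrite !fctE /GRing.scale /= /dtheta /theta /Phi /dPhi !invrN !mulrN.
rewrite !mul0r !subr0 [-1 + _]addrC; ring.
Qed.

Lemma testf_test T lam eta : 0 < T -> 0 < eta ->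
  test_function [set p : R^o * R^o | 0 < p.1] (testf T lam eta).
Proof.
move=> T0 e0.
pose K : set (R^o * R^o) := `[T, 2 * T] `*` `[- (2 * eta), 2 * eta].
have cK : compact K by apply: compact_setX; exact: segment_compact.
have KO : closure [set p | testf T lam eta p != 0] `<=` K.
  (* [K] is closed, so it only has to contain the points where the function is nonzero. *)
  rewrite [X in _ `<=` X](closure_id _).1.
    apply: closure_subset => p /= p0; split; apply: contrapT => /= h; move/eqP: p0; apply.
      by rewrite /testf theta_out ?mul0r//; move: h; rewrite in_itv.
    rewrite /testf Phi_out ?mulr0// leNgt; apply/negP => /ltW h'; apply: h.
    by rewrite in_itv /= -ler_norml.
  by apply: compact_closed => //; exact: norm_hausdorff.
split.
- exact/bump_alg_smooth/testf_alg.
- apply: subclosed_compact KO => //; exact: closed_closure.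
- move=> p /KO[/= + _]; rewrite in_itv /= => /andP[h _]; exact: lt_le_trans h.
Qed.

End Cutoffs.

(** * The operator G on nonnegative functions *)

Section Kernel.
Variable R : realType.
Local Notation mu := (@lebesgue_measure R).
Implicit Types (h w : R -> R) (x y : R).

Lemma measurable_kernel : measurable_fun [set: R * R]
  (fun z : R * R => expR (- `|z.1 - z.2|)).
Proof.
apply: measurableT_comp => //; apply: measurableT_comp => //.
by apply: measurableT_comp => //; apply: measurable_funB.
Qed.

Lemma measurable_kernel_l x : measurable_fun [set: R] (fun y => expR (- `|x - y|)).
Proof.
apply: measurableT_comp => //; apply: measurableT_comp => //.
by apply: measurableT_comp => //; apply: measurable_funB.
Qed.

Lemma measurable_kernel_r y : measurable_fun [set: R] (fun x => expR (- `|x - y|)).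
Proof.
apply: measurableT_comp => //; apply: measurableT_comp => //.
by apply: measurableT_comp => //; apply: measurable_funB.
Qed.

Lemma integral_expR_tail y :
  (\int[mu]_(x in `[y, +oo[) (expR (- `|x - y|))%:E = 1)%E.
Proof.
have E x : x \in `[y, +oo[ -> expR (- `|x - y|) = expR (y - x).
  by rewrite in_itv /= andbT => yx; rewrite ger0_norm ?subr_ge0// opprB.
transitivity (\int[mu]_(x in `[y, +oo[) (expR (y - x))%:E)%E.
  by apply: eq_integral => x; rewrite inE /= => /E ->.
have de x : is_derive x (1:R) (fun x : R => expR (y - x)) (- expR (y - x)).
  have dg : is_derive x (1:R) (fun x : R => y - x) (-1).
    exact: is_derive_eq (is_deriveB (is_derive_cst y x 1) (is_derive_id x 1)) (sub0r 1).
  have df := is_derive_expR (y - x).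
  apply: is_derive_eq (@is_derive1_comp R expR (fun x : R => y - x) x _ _ df dg) _.
  by rewrite mulrN1.
have ce : continuous (fun x : R => expR (y - x)).
  by move=> x; apply: differentiable_continuous; apply/derivable1_diffP; case: (de x).
have dF x : is_derive x (1:R) (fun x : R => - expR (y - x)) (expR (y - x)).
  by apply: is_derive_eq (is_deriveN (de x)) (opprK _).
rewrite (@ge0_continuous_FTC2y _ _ (fun x => - expR (y - x)) y 0).
- by rewrite subrr expR0 EFinN oppeK add0e.
- by move=> x _; exact: expR_ge0.
- exact: continuous_subspaceT.
- rewrite -oppr0; apply: cvgN; rewrite -(mulr0 (expR y)).
  under eq_fun do rewrite expRD.
  by apply: cvgMr; exact: cvgr_expR.
- by move=> x _; case: (dF x).
- by apply: cvg_at_right_filter; apply: cvgN; exact: ce.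
- by move=> x _; rewrite derive1E; case: (dF x).
Qed.

Lemma integral_expR_abs y : (\int[mu]_x (expR (- `|x - y|))%:E = 2%:E)%E.
Proof.
have ck : continuous (fun x : R => expR (- `|x - y|)).
  move=> x; apply: continuous_comp; last exact: continuous_expR.
  apply: cvgN; apply: cvg_norm; apply: cvgB; first exact: cvg_id.
  exact: cvg_cst.
rewrite -(setvU `]-oo, y]%classic) setCitvl.
rewrite ge0_integral_setU//=; last 2 first.
- by apply/measurable_EFinP; apply: measurable_funTS; exact: measurable_kernel_r.
- rewrite disj_set2E; apply/eqP; rewrite -subset0 => x /=.
  by rewrite !in_itv /= andbT => -[h]; rewrite leNgt h.
rewrite integral_itv_obnd_cbnd; last first.
  by apply/measurable_EFinP; apply: measurable_funTS; exact: measurable_kernel_r.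
(* The reflection [x -> -x] turns the left half into a right tail based at [-y]. *)
rewrite integral_expR_tail -(opprK y) ge0_integration_by_substitutionNy.
- rewrite opprK; transitivity (1 + \int[mu]_(x in `[(- y)%R, +oo[) (expR (- `|x - (- y)|))%:E)%E.
    congr (_ + _)%E; apply: eq_integral => x _ /=.
    by rewrite opprK -normrN opprB opprK addrC.
  by rewrite integral_expR_tail -EFinD.
- by apply: continuous_subspaceT; rewrite opprK.
- by move=> x _; exact: expR_ge0.
Qed.

Section Convolution.
Variable h : R -> R.
Hypotheses (mh : measurable_fun [set: R] h) (h0 : forall y, 0 <= h y).
Hypothesis fh : (\int[mu]_y (h y)%:E < +oo)%E.

Lemma measurable_conv_kernel : measurable_fun [set: R * R]
  (fun z : R * R => expR (- `|z.1 - z.2|) * h z.2).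
Proof.
apply: measurable_funM; first exact: measurable_kernel.
by apply: measurableT_comp => //.
Qed.

Lemma integral_indicM (L : set R) (f : R -> R) :
  (\int[mu]_(x in L) (f x)%:E = \int[mu]_x (\1_L x * f x)%:E)%E.
Proof.
rewrite integral_mkcond; apply: eq_integral => x _.
by rewrite patchE indicE; case: ifPn => _; rewrite ?mul1r ?mul0r.
Qed.

(** The real-valued integral in [G_op] agrees with the extended one because the kernel is at most 1
    and [h] has finite integral. *)
Lemma G_opE x : (G_op h x)%:E =
  (2^-1%:E * \int[mu]_y (expR (- `|x - y|) * h y)%:E)%E.
Proof.
rewrite /G_op EFinM /Rintegral fineK//.
rewrite ge0_fin_numE; last first.
  by apply: integral_ge0 => y _; rewrite lee_fin mulr_ge0 ?expR_ge0.
apply: le_lt_trans fh; apply: ge0_le_integral => //.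
- by move=> y _; rewrite lee_fin mulr_ge0 ?expR_ge0.
- apply/measurable_EFinP; apply: measurable_funM => //.
  exact: measurable_kernel_l.
- exact/measurable_EFinP.
- by move=> y _; rewrite lee_fin -[leRHS]mul1r ler_wpM2r//.
Qed.

Lemma G_op_ge0 x : 0 <= G_op h x.
Proof.
rewrite -lee_fin G_opE mule_ge0 ?lee_fin//.
by apply: integral_ge0 => y _; rewrite lee_fin mulr_ge0 ?expR_ge0.
Qed.

Lemma measurable_G_op : measurable_fun [set: R] (G_op h).
Proof.
apply/measurable_EFinP.
rewrite (_ : _ \o _ = fun x => (2^-1%:E * \int[mu]_y (expR (- `|x - y|) * h y)%:E)%E); last first.
  by apply/funext => x; rewrite /= G_opE.
apply: measurable_funeM.
apply: (@measurable_fun_fubini_tonelli_F _ _ _ _ _ mu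
  (fun z : R * R => (expR (- `|z.1 - z.2|) * h z.2)%:E)).
  apply/measurable_EFinP; exact: measurable_conv_kernel.
by move=> z; rewrite lee_fin mulr_ge0 ?expR_ge0.
Qed.

(** Tonelli moves the weight onto the kernel. The weight 1 gives the total mass, and the indicator
    of [(-lam, lam)] gives the local lower bound. *)
Lemma integral_G_op w : measurable_fun [set: R] w -> (forall x, 0 <= w x) ->
  (\int[mu]_x (w x * G_op h x)%:E =
   2^-1%:E * \int[mu]_y ((h y)%:E * \int[mu]_x (w x * expR (- `|x - y|))%:E))%E.
Proof.
move=> mw w0.
pose f (z : R * R) := (w z.1 * (expR (- `|z.1 - z.2|) * h z.2))%:E.
have mf : measurable_fun [set: R * R] f.
  apply/measurable_EFinP; apply: measurable_funM; first exact: measurableT_comp.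
  exact: measurable_conv_kernel.
have f0 z : (0 <= f z)%E by rewrite lee_fin !mulr_ge0 ?expR_ge0.
transitivity (2^-1%:E * \int[mu]_x \int[mu]_y f (x, y))%E.
  rewrite -ge0_integralZl//; last 2 first.
  - exact: measurable_fun_fubini_tonelli_F.
  - by move=> x _; apply: integral_ge0.
  apply: eq_integral => x _; rewrite EFinM G_opE muleCA; congr (_ * _)%E.
  rewrite -ge0_integralZl//.
  - apply/measurable_EFinP; apply: measurable_funM => //.
    exact: measurable_kernel_l.
  - by move=> y _; rewrite lee_fin mulr_ge0 ?expR_ge0.
  - by rewrite lee_fin.
rewrite fubini_tonelli//; congr (_ * _)%E.
apply: eq_integral => y _.
rewrite -ge0_integralZl//.
- by apply: eq_integral => x _; rewrite /f -EFinM; congr EFin; rewrite /=; ring.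
- apply/measurable_EFinP; apply: measurable_funM => //.
  exact: measurable_kernel_r.
- by move=> x _; rewrite lee_fin mulr_ge0 ?expR_ge0.
- by rewrite lee_fin.
Qed.

Lemma integral_G_op_total : (\int[mu]_x (G_op h x)%:E = \int[mu]_y (h y)%:E)%E.
Proof.
transitivity (\int[mu]_x (cst 1 x * G_op h x)%:E)%E.
  by apply: eq_integral => x _; rewrite mul1r.
rewrite integral_G_op//.
under eq_integral => y _.
  under eq_integral do rewrite mul1r.
  rewrite integral_expR_abs muleC.
  over.
rewrite ge0_integralZl//; last 2 first.
- exact/measurable_EFinP.
- by move=> y _; rewrite lee_fin.
by rewrite muleA -EFinM mulVf// mul1e.
Qed.

(** After Tonelli it is enough that, for each [y] in [(-lam, lam)], the kernel has mass at least
    [exp(-1)] on that interval. A unit interval at distance at most 1 from [y] provides it. *)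
Lemma integral_G_op_local (lam : R) : 1 <= lam ->
  ((expR (-1) / 2)%:E * \int[mu]_(y in `](- lam)%R, lam[) (h y)%:E
   <= \int[mu]_(x in `](- lam)%R, lam[) (G_op h x)%:E)%E.
Proof.
move=> l1.
set L := `](- lam), lam[%classic.
have mL : measurable L by exact: measurable_itv.
rewrite (integral_indicM L (G_op h)) (integral_indicM L h) integral_G_op//.
rewrite mulrC EFinM -muleA lee_pmul2l//.
rewrite -ge0_integralZl//; last 2 first.
- apply/measurable_EFinP; apply: measurable_funM => //; exact: measurable_indic.
- by move=> y _; rewrite lee_fin mulr_ge0.
apply: ge0_le_integral => //.
- by move=> y _; rewrite mule_ge0// lee_fin ?expR_ge0// mulr_ge0.
- apply: measurable_funeM; apply/measurable_EFinP; apply: measurable_funM => //.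
- apply: emeasurable_funM; first exact/measurable_EFinP.
  pose g (z : R * R) := (\1_L z.2 * expR (- `|z.2 - z.1|))%:E.
  apply: (@measurable_fun_fubini_tonelli_F _ _ _ _ _ mu g).
    apply/measurable_EFinP; apply: measurable_funM.
      by apply: measurableT_comp => //; exact: measurable_indic.
    rewrite (_ : (fun _ => _) = fun z : R * R => expR (- `|z.1 - z.2|)).
      exact: measurable_kernel.
    by apply/funext => z; rewrite distrC.
  by move=> z; rewrite lee_fin mulr_ge0 ?expR_ge0.
move=> y _; rewrite indicE; case: (boolP (y \in L)) => yL; last first.
  by rewrite mul0r mule0 mule_ge0 ?lee_fin// integral_ge0.
rewrite mul1r muleC lee_wpmul2l ?lee_fin//.
move: yL; rewrite inE /L /= in_itv /= => /andP[y1 y2].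
(* The unit interval has [y] as an endpoint and extends towards the origin; [1 <= lam] keeps it
   inside. *)
have [a [a1 a2 a3 a4]] : exists a, [/\ - lam <= a, a + 1 <= lam, a <= y & y <= a + 1].
  have [yn|yp] := leP y 0; first by exists y; split; lra.
  by exists (y - 1); split; lra.
have mJ : measurable (`]a, (a + 1)[%classic : set R) by exact: measurable_itv.
rewrite -[leLHS]mule1.
rewrite (_ : 1%E = mu `]a, (a + 1)[%classic); last first.
  by rewrite lebesgue_measure_itv/= lte_fin ltrDl ltr01 -EFinD addrAC subrr add0r.
rewrite -[X in mu X]setIT -integral_indic// -ge0_integralZl//; last first.
  by apply/measurable_EFinP; exact: measurable_indic.
apply: ge0_le_integral => //.
- by apply: measurable_funeM; apply/measurable_EFinP; exact: measurable_indic.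
- apply/measurable_EFinP; apply: measurable_funM; last exact: measurable_kernel_r.
  exact: measurable_indic.
move=> x _; rewrite -EFinM lee_fin indicE; case: (boolP (x \in _)); last first.
  by rewrite mulr0 mulr_ge0 ?expR_ge0.
rewrite inE /= in_itv /= => /andP[x1 x2].
rewrite mulr1 indicE mem_set ?mul1r; last by rewrite /L /= in_itv /=; lra.
rewrite ler_expR lerN2 ler_norml; lra.
Qed.

End Convolution.
End Kernel.

(** * Integrals of non-measurable functions *)

Section LowerIntegral.
Local Open Scope ereal_scope.
Context (d : measure_display) (T : measurableType d) (R : realType).
Variables (mu : {measure set T -> \bar R}) (D : set T).
Hypothesis mD : measurable D.
Implicit Types f g : T -> \bar R.

(* [integral] is a supremum over simple functions below the integrand, so it is
   monotone even when the integrand is not measurable; no measurability in [t]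
   of the solution is thus needed. *)
Lemma le_integral_any f g : (forall x, D x -> f x <= g x) ->
  \int[mu]_(x in D) f x <= \int[mu]_(x in D) g x.
Proof.
move=> fg; rewrite /integral /=.
have H x : (f \_ D) x <= (g \_ D) x.
  by rewrite !patchE; case: ifPn => // /set_mem; exact: fg.
apply: leeB; apply: ereal_sup_le => _ [h /= hf <-]; exists h => // x.
- by apply: (le_trans (hf x)); rewrite !funeposE ge_max !le_max H lexx orbT.
- by apply: (le_trans (hf x)); rewrite !funenegE ge_max !le_max leeN2 H lexx orbT.
Qed.

Lemma measurable_patch_cst f (N : set T) (c : \bar R) : measurable N ->
  measurable_fun D f -> measurable_fun D (fun x => if x \in N then c else f x).
Proof.
move=> mN mf; apply: measurable_fun_if => //.
- apply: (measurable_fun_bool true); rewrite (_ : _ @^-1` _ = N) ?setIid//; last first.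
    by apply/seteqP; split => x /= => [/set_mem|/mem_set].
  exact: measurableI.
- by apply: measurable_funS mf => //; exact: subIsetl.
Qed.

Lemma integral_patch_cst f (N : set T) (c : \bar R) :
  measurable N -> mu N = 0 -> measurable_fun D f ->
  \int[mu]_(x in D) (if x \in N then c else f x) = \int[mu]_(x in D) f x.
Proof.
move=> mN N0 mf; apply: ae_eq_integral => //; first exact: measurable_patch_cst.
exists N; split => // x /=; apply: contra_notP => xN _.
by rewrite memNset.
Qed.

(** Setting the measurable side to [-oo] on the exceptional null set keeps its integral and makes
    the comparison hold everywhere, so monotonicity for arbitrary integrands applies. The companion
    lemma uses [+oo]. *)
Lemma ae_le_integral_any f g : measurable_fun D f ->
  {ae mu, forall x, D x -> f x <= g x} ->
  \int[mu]_(x in D) f x <= \int[mu]_(x in D) g x.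
Proof.
move=> mf [N [mN N0 fgN]]; rewrite -(integral_patch_cst -oo mN N0 mf).
apply: le_integral_any => x Dx; case: ifPn => [_|]; first exact: leNye.
by move/negP; apply: contra_notP => h; apply/mem_set/fgN => /= /(_ Dx).
Qed.

Lemma ae_ge_integral_any f g : measurable_fun D f ->
  {ae mu, forall x, D x -> g x <= f x} ->
  \int[mu]_(x in D) g x <= \int[mu]_(x in D) f x.
Proof.
move=> mf [N [mN N0 fgN]]; rewrite -(integral_patch_cst +oo mN N0 mf).
apply: le_integral_any => x Dx; case: ifPn => [_|]; first exact: leey.
by move/negP; apply: contra_notP => h; apply/mem_set/fgN => /= /(_ Dx).
Qed.

End LowerIntegral.

(** * Consequence of a vanishing integral in time *)

Section ZeroIntegral.
Variable R : realType.
Local Notation mu := (@lebesgue_measure R).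

(** Integrating the lower bound gives [B * T / 2 - A * T <= 0], as the two intervals have lengths
    [T / 2] and [T]. The upper bound with [C] supplies finiteness. *)
Lemma zero_Rintegral_bound (g : R -> R) (T A B C : R) : 0 < T ->
  \int[mu]_(t in `]0, +oo[) g t = 0 ->
  {ae mu, forall t, 0 < t ->
    B * \1_(`[5 / 4 * T, 7 / 4 * T]) t - A * \1_(`[T, 2 * T]) t <= g t
    <= C * \1_(`[T, 2 * T]) t} ->
  B / 2 <= A.
Proof.
move=> T0 g0 gb.
set D := `]0, +oo[%classic in g0 *; set I := `[T, 2 * T]%classic in gb *.
set J := `[5 / 4 * T, 7 / 4 * T]%classic in gb *.
have mD : measurable D by exact: measurable_itv.
have mI : measurable I by exact: measurable_itv.
have mJ : measurable J by exact: measurable_itv.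
have ID : I `<=` D.
  by move=> t; rewrite /I /D /= !in_itv /= andbT => /andP[h _]; exact: lt_le_trans h.
have JD : J `<=` D.
  move=> t; rewrite /J /D /= !in_itv /= andbT => /andP[h _]; apply: lt_le_trans h.
  by rewrite mulr_gt0.
have muI : mu I = T%:E.
  rewrite /I lebesgue_measure_itv /= lte_fin ifT -?EFinD; last by lra.
  by congr EFin; ring.
have muJ : mu J = (T / 2)%:E.
  rewrite /J lebesgue_measure_itv /= lte_fin ifT -?EFinD; last by lra.
  by congr EFin; field.
have iI k : mu.-integrable D (fun t => (k * \1_I t)%:E).
  under eq_fun do rewrite EFinM.
  apply: integrableZl => //.
  apply: (@integrableS _ _ _ _ setT) => //; exact: integrable_indic_itv.
have iJ k : mu.-integrable D (fun t => (k * \1_J t)%:E).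
  under eq_fun do rewrite EFinM.
  apply: integrableZl => //.
  apply: (@integrableS _ _ _ _ setT) => //; exact: integrable_indic_itv.
have eI k : (\int[mu]_(t in D) (k * \1_I t)%:E = (k * T)%:E)%E.
  under eq_integral do rewrite EFinM.
  rewrite integralZl//; last by have := iI 1; under eq_fun do rewrite mul1r.
  by rewrite integral_indic// setIidl// EFinM; congr (_ * _)%E; exact: muI.
have eJ k : (\int[mu]_(t in D) (k * \1_J t)%:E = (k * (T / 2))%:E)%E.
  under eq_integral do rewrite EFinM.
  rewrite integralZl//; last by have := iJ 1; under eq_fun do rewrite mul1r.
  by rewrite integral_indic// setIidl// EFinM; congr (_ * _)%E; exact: muJ.
have lo : ((B * (T / 2) - A * T)%:E <= \int[mu]_(t in D) (g t)%:E)%E.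
  rewrite EFinB -eI -eJ -integralB_EFin; [|exact: mD|exact: iJ|exact: iI].
  apply: ae_le_integral_any => //.
    by apply: emeasurable_funB; [have /integrableP[] := iJ B | have /integrableP[] := iI A].
  apply: negligibleS gb => t /=; apply: contra_not => h.
  by rewrite /D /= in_itv /= andbT => /h /andP[+ _]; rewrite -EFinB lee_fin.
have up : (\int[mu]_(t in D) (g t)%:E <= (C * T)%:E)%E.
  rewrite -eI; apply: ae_ge_integral_any => //; first by have /integrableP[] := iI C.
  apply: negligibleS gb => t /=; apply: contra_not => h.
  by rewrite /D /= in_itv /= andbT => /h /andP[_ +]; rewrite lee_fin.
(* Without finiteness the value 0 in [g0] could be the default that [fine] assigns to an infinite
   integral. *)
have fin : (\int[mu]_(t in D) (g t)%:E)%E \is a fin_num.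
  rewrite fin_numElt; apply/andP; split; first exact: lt_le_trans (ltNyr _) lo.
  exact: le_lt_trans up (ltry _).
have : (\int[mu]_(t in D) (g t)%:E = 0)%E.
  by rewrite -(fineK fin); congr EFin.
move=> h; move: lo; rewrite h lee_fin.
have -> : B * (T / 2) - A * T = (B / 2 - A) * T by field.
by rewrite pmulr_lle0// subr_le0.
Qed.

End ZeroIntegral.

(** * The virial estimate *)

Section Slices.
Variable R : realType.
Local Notation mu := (@lebesgue_measure R).
Implicit Types (f g v F : R -> R) (lam eta s E : R).

Lemma EFin_Rintegral f : mu.-integrable setT (EFin \o f) ->
  ((\int[mu]_x f x)%R%:E = \int[mu]_x (f x)%:E)%E.
Proof.
move=> fi; rewrite /Rintegral fineK//.
exact: (integrable_fin_num measurableT fi).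
Qed.

Lemma ge0_integrable f E : measurable_fun setT f -> (forall x, 0 <= f x) ->
  (\int[mu]_x (f x)%:E <= E%:E)%E -> mu.-integrable setT (EFin \o f).
Proof.
move=> mf f0 fE; apply/integrableP; split; first exact/measurable_EFinP.
under eq_integral => x _ do rewrite /= ger0_norm//.
exact: le_lt_trans fE (ltry _).
Qed.

Lemma integrable_scale c f : mu.-integrable setT (EFin \o f) ->
  mu.-integrable setT (EFin \o (fun x => c * f x)).
Proof.
move=> h; rewrite (_ : _ \o _ = fun x => (c%:E * (f x)%:E)%E).
  exact: integrableZl.
by apply/funext => x /=; rewrite EFinM.
Qed.

Lemma measurable_bump n : measurable_fun setT (@bump R n).
Proof. by apply: continuous_measurable_fun; exact: continuous_bump. Qed.

Lemma measurable_bump_affine n (a c : R) :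
  measurable_fun setT (fun x : R => bump n (c + x / a)).
Proof.
apply: measurableT_comp; first exact: measurable_bump.
by apply: measurable_funD => //; apply: measurable_funM.
Qed.

Lemma measurable_bump_affineN n (a c : R) :
  measurable_fun setT (fun x : R => bump n (c - x / a)).
Proof.
apply: measurableT_comp; first exact: measurable_bump.
by apply: measurable_funB => //; apply: measurable_funM.
Qed.

Lemma measurable_Phi lam eta : measurable_fun setT (Phi lam eta).
Proof.
apply: measurable_funM; first exact: measurable_bump_affine.
apply: measurable_funM; first exact: measurable_bump_affine.
exact: measurable_bump_affineN.
Qed.

Lemma measurable_dPhi lam eta : measurable_fun setT (dPhi lam eta).
Proof.
have H m n c d : measurable_fun setT
    (fun x : R => bump m (c + x / eta) * bump n (d - x / eta)).
  apply: measurable_funM; first exact: measurable_bump_affine.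
  exact: measurable_bump_affineN.
apply: measurable_funD; apply: measurable_funM => //.
  by apply: measurable_funM => //; exact: measurable_bump_affine.
apply: measurable_funM; first exact: measurable_bump_affine.
exact: measurable_funB.
Qed.

(** The support has length [4 s^2], so the weight [1 / (2 s)] on its indicator integrates to [2 s];
    the square term gives [s * E / 2]. *)
Lemma momentum_bound v lam s E : 0 < s -> measurable_fun setT v ->
  (\int[mu]_x (v x ^+ 2)%:E <= E%:E)%E ->
  mu.-integrable setT (EFin \o (fun x => v x * Phi lam (s ^+ 2) x)) /\
  `|\int[mu]_x (v x * Phi lam (s ^+ 2) x)| <= s * (E / 2 + 2).
Proof.
move=> s0 mv vE.
set L := `[- (2 * s ^+ 2), 2 * s ^+ 2]%classic.
have mL : measurable L by exact: measurable_itv.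
have iv : mu.-integrable setT (EFin \o (fun x => v x ^+ 2)).
  by apply: ge0_integrable vE => [|x]; [exact: measurable_funX | exact: sqr_ge0].
have iL : mu.-integrable setT (EFin \o (\1_L : R -> R)).
  exact: integrable_indic_itv.
pose g x := s / 2 * v x ^+ 2 + (2 * s)^-1 * \1_L x.
have i1 : mu.-integrable setT (EFin \o (fun x => s / 2 * v x ^+ 2)).
  exact: integrable_scale.
have i2 : mu.-integrable setT (EFin \o (fun x => (2 * s)^-1 * (\1_L x : R))).
  exact: integrable_scale.
have ig : mu.-integrable setT (EFin \o g).
  by apply: eq_integrable (integrableD measurableT i1 i2).
have e0 : 0 < s ^+ 2 by rewrite exprn_gt0.
have g0 x : 0 <= g x.
  have s2 : 0 <= s / 2 by rewrite divr_ge0// ltW.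
  have s3 : 0 <= (2 * s)^-1 by rewrite invr_ge0 mulr_ge0// ltW.
  by rewrite /g indicE addr_ge0// mulr_ge0// ?sqr_ge0.
(* AM-GM with weight [s], the square root of the width of the support. *)
have bnd x : `|v x * Phi lam (s ^+ 2) x| <= g x.
  have [xL|xL] := boolP (x \in L); last first.
    rewrite Phi_out ?mulr0 ?normr0// leNgt; apply: contra xL => /ltW h.
    by rewrite inE /L /= in_itv /= -ler_norml.
  rewrite normrM (ger0_norm (Phi_ge0 _ _ _)) /g indicE xL mulr1.
  apply: (@le_trans _ _ `|v x|).
    by rewrite -[leRHS]mulr1 ler_pM ?Phi_ge0 ?Phi_le1.
  rewrite -(real_normK (num_real (v x))).
  set y := `|v x|.
  have -> : s / 2 * y ^+ 2 + (2 * s)^-1 = y + (2 * s)^-1 * (s * y - 1) ^+ 2.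
    by field; rewrite gt_eqF.
  by rewrite lerDl mulr_ge0 ?sqr_ge0// invr_ge0 mulr_ge0 ?ltW.
have mf : measurable_fun setT (fun x => v x * Phi lam (s ^+ 2) x).
  by apply: measurable_funM => //; exact: measurable_Phi.
have ivp : mu.-integrable setT (EFin \o (fun x => v x * Phi lam (s ^+ 2) x)).
  apply: le_integrable ig => //; first exact/measurable_EFinP.
  by move=> x _ /=; rewrite lee_fin (ger0_norm (g0 x)).
split=> //.
apply: le_trans (le_normr_Rintegral measurableT ivp) _.
apply: (@le_trans _ _ (\int[mu]_x g x)).
  by apply: le_Rintegral => //; exact: integrable_norm ivp.
rewrite RintegralD// !RintegralZl//.
have hv : \int[mu]_x (v x ^+ 2) <= E by rewrite -lee_fin EFin_Rintegral.
have hL : \int[mu]_x (\1_L x : R) = 4 * s ^+ 2.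
  apply: EFin_inj; rewrite EFin_Rintegral// integral_indic// setIT.
  rewrite -[LHS]/(mu L) /L lebesgue_measure_itv /= lte_fin ifT; last by lra.
  by rewrite -EFinD; congr EFin; ring.
rewrite hL.
have -> : (2 * s)^-1 * (4 * s ^+ 2) = s * 2 by field; rewrite gt_eqF.
rewrite [leRHS]mulrDr lerD2r -mulrA ler_pM2l// mulrC ler_pM2r//.
Qed.

(** Since [F >= 0], a pointwise minorant of [dPhi] may be multiplied by it: a multiple of [1 / lam]
    on the core, minus [2 / eta] everywhere. *)
Lemma flux_bound F lam eta (A K : R) : 0 < lam -> lam <= eta ->
  measurable_fun setT F -> (forall x, 0 <= F x) ->
  (\int[mu]_x (F x)%:E <= A%:E)%E ->
  (K%:E <= \int[mu]_(x in `](- lam)%R, lam[) (F x)%:E)%E ->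
  [/\ mu.-integrable setT (EFin \o (fun x => F x * dPhi lam eta x)),
   bump 0 1 ^+ 3 / 9 / lam * K - 2 / eta * A <= \int[mu]_x (F x * dPhi lam eta x) &
   \int[mu]_x (F x * dPhi lam eta x) <= (2 / lam + 2 / eta) * A].
Proof.
move=> l0 le mF F0 FA FK; have e0 := lt_le_trans l0 le.
set L := `]- lam, lam[%classic in FK.
have mL : measurable L by exact: measurable_itv.
have iF := ge0_integrable mF F0 FA.
have mFL : measurable_fun setT (fun x => \1_L x * F x).
  by apply: measurable_funM => //; exact: measurable_indic.
have iFL : mu.-integrable setT (EFin \o (fun x => \1_L x * F x)).
  apply: le_integrable iF => //; first exact/measurable_EFinP.
  move=> x _ /=; rewrite lee_fin normrM ler_piMl// indicE.
  by case: (x \in L); rewrite ?normr1// normr0.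
have mFP : measurable_fun setT (fun x => F x * dPhi lam eta x).
  by apply: measurable_funM => //; exact: measurable_dPhi.
have c0 : 0 <= 2 / lam + 2 / eta by rewrite addr_ge0// divr_ge0// ltW.
have iFP : mu.-integrable setT (EFin \o (fun x => F x * dPhi lam eta x)).
  apply: le_integrable (integrable_scale (2 / lam + 2 / eta) iF) => //.
    exact/measurable_EFinP.
  move=> x _ /=; rewrite lee_fin !normrM mulrC (ger0_norm c0).
  by rewrite ler_wpM2r// dPhi_le.
have hA : \int[mu]_x F x <= A by rewrite -lee_fin EFin_Rintegral.
have hK : K <= \int[mu]_x (\1_L x * F x).
  by rewrite -lee_fin EFin_Rintegral//; move: FK; rewrite integral_indicM.
split => //.
- set k := bump 0 1 ^+ 3 / 9 / lam.
  have k0 : 0 <= k by rewrite !divr_ge0 ?exprn_ge0 ?bump_ge0// ltW.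
  apply: (@le_trans _ _ (\int[mu]_x (k * (\1_L x * F x) - 2 / eta * F x))).
    rewrite RintegralB//; [|exact: integrable_scale|exact: integrable_scale].
    rewrite !RintegralZl// lerB// ler_wpM2l// divr_ge0// ltW//.
  apply: le_Rintegral => //.
    have h1 := integrable_scale k iFL; have h2 := integrable_scale (2 / eta) iF.
    by apply: eq_integrable (integrableB measurableT h1 h2).
  move=> x _; rewrite mulrA -mulrBl mulrC ler_wpM2l//.
  rewrite indicE; have [xL|xL] := boolP (x \in L).
    rewrite mulr1 dPhi_core//; move: xL.
    by rewrite inE /L /= in_itv /= ltr_norml.
  by rewrite mulr0 sub0r dPhi_ge.
- apply: (@le_trans _ _ (\int[mu]_x ((2 / lam + 2 / eta) * F x))).
    apply: le_Rintegral => //; first exact: integrable_scale.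
    move=> x _; rewrite mulrC ler_wpM2r//.
    by rewrite (le_trans (ler_norm _))// dPhi_le.
  by rewrite RintegralZl// ler_wpM2l.
Qed.

End Slices.

(** * Energy and flux at a fixed time, and the choice of scales *)

Section Virial.
Variable R : realType.
Local Notation mu := (@lebesgue_measure R).

(** Membership in [H1] makes the set behind [get] nonempty, so the chosen representative is a
    genuine weak derivative, and local integrability contains measurability. *)
Lemma H1_measurable (v : R -> R) : H1 v ->
  measurable_fun setT v /\ measurable_fun setT (weak_derivative v).
Proof.
move=> [_ [g [vg _]]].
by have [[mv _ _] [mw _ _] _] := getPex (ex_intro (is_weak_derivative v) g vg).
Qed.

Lemma H1_norm_ge0 (L : set R) (v : R -> R) : (0 <= H1_norm L v)%E.
Proof. exact: sqrte_ge0. Qed.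

Lemma energy_ge0 (L : set R) (v : R -> R) :
  (0 <= \int[mu]_(x in L) (v x ^+ 2 + weak_derivative v x ^+ 2)%:E)%E.
Proof. by apply: integral_ge0 => x _; rewrite lee_fin addr_ge0 ?sqr_ge0. Qed.

Lemma H1_norm_le (L : set R) (v : R -> R) (M : R) : (H1_norm L v <= M%:E)%E ->
  (\int[mu]_(x in L) (v x ^+ 2 + weak_derivative v x ^+ 2)%:E <= (M ^+ 2)%:E)%E.
Proof.
move=> h; rewrite -lee_sqrt ?lee_fin ?sqr_ge0//.
rewrite [leRHS]/sqrte sqrtr_sqr; apply: (le_trans h).
by rewrite lee_fin ler_norm.
Qed.

Lemma H1_norm_ge (L : set R) (v : R -> R) (d : R) : 0 <= d ->
  (d%:E <= H1_norm L v)%E ->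
  ((d ^+ 2)%:E <= \int[mu]_(x in L) (v x ^+ 2 + weak_derivative v x ^+ 2)%:E)%E.
Proof.
move=> d0 h; rewrite -lee_sqrt ?energy_ge0//.
by apply: le_trans h; rewrite [leLHS]/sqrte sqrtr_sqr ger0_norm.
Qed.

Section Flux.
Variables (b : R) (v : R -> R) (E : R).
Hypotheses (hb : 0 < b < 3) (mv : measurable_fun setT v)
  (mw : measurable_fun setT (weak_derivative v)).
Hypothesis vE :
  (\int[mu]_x (v x ^+ 2 + weak_derivative v x ^+ 2)%:E <= E%:E)%E.

Let w := weak_derivative v.
Let h (y : R) := b / 2 * v y ^+ 2 + (3 - b) / 2 * w y ^+ 2.
Let e (y : R) := v y ^+ 2 + w y ^+ 2.

Let me : measurable_fun setT e.
Proof. by apply: measurable_funD; exact: measurable_funX. Qed.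

Let e0 y : 0 <= e y.
Proof. by rewrite addr_ge0 ?sqr_ge0. Qed.

Let mh : measurable_fun setT h.
Proof.
by apply: measurable_funD; apply: measurable_funM => //; exact: measurable_funX.
Qed.

Let h0 y : 0 <= h y.
Proof.
have /andP[b0 b3] := hb.
by rewrite addr_ge0// mulr_ge0 ?sqr_ge0// divr_ge0// ?subr_ge0 ltW.
Qed.

Let h_le y : h y <= 3 / 2 * e y.
Proof.
have /andP[? ?] := hb; rewrite /h /e.
have := sqr_ge0 (v y); have := sqr_ge0 (w y); nra.
Qed.

(** The constant is positive exactly when [0 < b < 3]; this coercivity lets the flux control the
    full local energy. *)
Let h_ge y : Num.min b (3 - b) / 2 * e y <= h y.
Proof.
rewrite /e mulrDr lerD// ler_wpM2r ?sqr_ge0// ler_pM2r// ge_min lexx//.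
by rewrite orbT.
Qed.

Let intZ (L : set R) (c : R) (f : R -> R) : measurable L -> 0 <= c ->
  measurable_fun setT f -> (forall x, 0 <= f x) ->
  (\int[mu]_(x in L) (c * f x)%:E = c%:E * \int[mu]_(x in L) (f x)%:E)%E.
Proof.
move=> mL c0 mf f0; under eq_integral do rewrite EFinM.
rewrite ge0_integralZl ?lee_fin//.
  by apply/measurable_EFinP; exact: measurable_funTS.
by move=> x _; rewrite lee_fin.
Qed.

Let le_int (L : set R) (f g : R -> R) : measurable L ->
  measurable_fun setT f -> measurable_fun setT g -> (forall x, 0 <= f x) ->
  (forall x, f x <= g x) ->
  (\int[mu]_(x in L) (f x)%:E <= \int[mu]_(x in L) (g x)%:E)%E.
Proof.
move=> mL mf mg f0 fg; apply: ge0_le_integral => //.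
- by move=> x _; rewrite lee_fin.
- by apply/measurable_EFinP; exact: measurable_funTS.
- by apply/measurable_EFinP; exact: measurable_funTS.
- by move=> x _; rewrite lee_fin.
Qed.

Lemma energy_square_le : (\int[mu]_x (v x ^+ 2)%:E <= E%:E)%E.
Proof.
apply: le_trans vE; apply: le_int => //.
- exact: measurable_funX.
- by move=> x; exact: sqr_ge0.
- by move=> x; rewrite lerDl sqr_ge0.
Qed.

Let hE : (\int[mu]_y (h y)%:E <= (3 / 2 * E)%:E)%E.
Proof.
apply: (@le_trans _ _ (\int[mu]_y (3 / 2 * e y)%:E)%E).
  by apply: le_int => //; exact: measurable_funM.
by rewrite intZ// [(3 / 2 * E)%:E]EFinM lee_pmul2l// lte_fin divr_gt0.
Qed.

Let hfin : (\int[mu]_y (h y)%:E < +oo)%E.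
Proof. exact: le_lt_trans hE (ltry _). Qed.

Let mG : measurable_fun setT (G_op h).
Proof. exact: measurable_G_op. Qed.

Lemma b_flux_ge0 x : 0 <= b_flux b v x.
Proof.
apply: addr_ge0; last exact: (G_op_ge0 mh h0 hfin).
by rewrite mulr_ge0 ?sqr_ge0.
Qed.

Lemma measurable_b_flux : measurable_fun setT (b_flux b v).
Proof.
by apply: measurable_funD => //; apply: measurable_funM => //; exact: measurable_funX.
Qed.

Lemma integral_b_flux_le : (\int[mu]_x (b_flux b v x)%:E <= (2 * E)%:E)%E.
Proof.
(* The local term contributes [E / 2]; [G] preserves total integrals, so it contributes at most
   [3 / 2 * E]. *)
rewrite (_ : 2 * E = 2^-1 * E + 3 / 2 * E); last by field.
under eq_integral do rewrite EFinD.
have mv2 : measurable_fun setT (fun x => 2^-1 * v x ^+ 2).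
  by apply: measurable_funM => //; exact: measurable_funX.
rewrite ge0_integralD//.
- rewrite EFinD leeD//.
    rewrite intZ//; [|exact: measurable_funX|by move=> x; exact: sqr_ge0].
    by rewrite [leRHS]EFinM lee_pmul2l// energy_square_le.
  by rewrite integral_G_op_total.
- by move=> x _; rewrite lee_fin mulr_ge0 ?sqr_ge0.
- exact/measurable_EFinP.
- by move=> x _; rewrite lee_fin (G_op_ge0 mh h0 hfin).
- exact/measurable_EFinP.
Qed.

(** The term [v^2 / 2] is dropped: the nonlocal term already dominates both [v^2] and the squared
    derivative. *)
Lemma integral_b_flux_ge (lam : R) : 1 <= lam ->
  ((expR (-1) / 2 * (Num.min b (3 - b) / 2))%:E *
     \int[mu]_(x in `](- lam)%R, lam[) (v x ^+ 2 + weak_derivative v x ^+ 2)%:E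
   <= \int[mu]_(x in `](- lam)%R, lam[) (b_flux b v x)%:E)%E.
Proof.
move=> l1.
have mL : measurable (`](- lam), lam[%classic : set R) by exact: measurable_itv.
apply: (@le_trans _ _ (\int[mu]_(x in `](- lam)%R, lam[) (G_op h x)%:E)%E).
  apply: le_trans (integral_G_op_local mh h0 hfin l1).
  rewrite EFinM -muleA lee_pmul2l//.
  have m0 : 0 <= Num.min b (3 - b) / 2.
    have /andP[? ?] := hb.
    by rewrite divr_ge0// le_min ltW//= subr_ge0 ltW.
  rewrite -(@intZ _ _ e)//; apply: le_int => //; first exact: measurable_funM.
  by move=> x; rewrite mulr_ge0.
apply: le_int => //; first exact: measurable_b_flux.
  by move=> x; exact: (G_op_ge0 mh h0 hfin).
by move=> x; rewrite lerDr mulr_ge0 ?sqr_ge0.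
Qed.

End Flux.

(** One fixed interval serves the whole time window: [2 s^3 <= (2 s)^3] gives [t^(2/3) <= 4 s^2],
    and [ln t >= ln s]. *)
Lemma Lambda_subset (s t : R) : 1 < s -> s ^+ 3 <= t <= 2 * s ^+ 3 ->
  Lambda (2 / 3) t `<=` `](- (4 * s ^+ 2 / ln s)), (4 * s ^+ 2 / ln s)[.
Proof.
move=> s1 /andP[t1 t2].
have s0 : 0 < s by apply: lt_trans s1.
have s3 : 0 < s ^+ 3 by rewrite exprn_gt0.
have t0 : 0 < t by apply: lt_le_trans t1.
have ls : 0 < ln s by rewrite ln_gt0.
have lst : ln s <= ln t.
  rewrite ler_ln ?posrE//; apply: le_trans t1.
  by rewrite ler_eXnr// ltW.
have pw : t `^ (2 / 3) <= 4 * s ^+ 2.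
  have -> : 4 * s ^+ 2 = ((2 * s) ^+ 3) `^ (2 / 3).
    rewrite -[X in X `^ _]powR_mulrn ?mulr_ge0 ?(ltW s0)// -powRrM.
    rewrite (_ : 3%:R * (2 / 3) = 2%:R) ?powR_mulrn ?mulr_ge0 ?(ltW s0)//; last by field.
    by ring.
  apply: ge0_ler_powR; rewrite ?nnegrE ?exprn_ge0 ?mulr_ge0 ?(ltW s0) ?(ltW t0)//.
  by apply: le_trans t2 _; rewrite exprMn ler_pM2r// -natrX ler_nat.
have H : t `^ (2 / 3) / ln t <= 4 * s ^+ 2 / ln s.
  rewrite ler_pM ?powR_ge0 ?invr_ge0 ?(le_trans (ltW ls))//.
  by rewrite lef_pV2 ?posrE// (lt_le_trans ls).
move=> x; rewrite /Lambda /= !in_itv /= => /andP[x1 x2].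
by rewrite (lt_le_trans x2 H) andbT (le_lt_trans _ x1)// lerN2.
Qed.

Lemma slice_bound (b E d s t : R) (v : R -> R) :
  0 < b < 3 -> H1 v ->
  (\int[mu]_x (v x ^+ 2 + weak_derivative v x ^+ 2)%:E <= E%:E)%E ->
  1 < s -> 4 <= ln s -> s ^+ 3 <= t <= 2 * s ^+ 3 ->
  (d%:E <= \int[mu]_(x in Lambda (2 / 3) t)
             (v x ^+ 2 + weak_derivative v x ^+ 2)%:E)%E ->
  let lam := 4 * s ^+ 2 / ln s in
  let c := expR (-1) / 2 * (Num.min b (3 - b) / 2) in
  let phi := testf (s ^+ 3) lam (s ^+ 2) in
  let beta := bump 0 1 ^+ 3 / 9 / lam * (c * d) - 2 / s ^+ 2 * (2 * E) in
  let I := \int[mu]_x (v x * 'D_(1, 0) phi (t, x) +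
                        b_flux b v x * 'D_(0, 1) phi (t, x)) in
  theta (s ^+ 3) t * beta - (E + 4) / s ^+ 2 <= I /\
  I <= (2 / lam + 2 / s ^+ 2) * (2 * E) + (E + 4) / s ^+ 2.
Proof.
move=> hb vH vE s1 ls tI vd lam c phi beta I.
have [mv mw] := H1_measurable vH.
have s0 : 0 < s by apply: lt_trans s1.
have s2 : 0 < s ^+ 2 by rewrite exprn_gt0.
have s3 : 0 < s ^+ 3 by rewrite exprn_gt0.
have l0 : 0 < ln s by apply: lt_le_trans ls.
have lam0 : 0 < lam by rewrite divr_gt0// mulr_gt0.
(* The 4 in [4 <= ln s] cancels the 4 in [lam]. *)
have lame : lam <= s ^+ 2 by rewrite ler_pdivrMr// mulrC ler_pM2l.
have lam1 : 1 <= lam.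
  rewrite ler_pdivlMr// mul1r.
  have : ln s <= s by rewrite -[leRHS]lnK ?posrE// (le_trans _ (expR_ge1Dx _))// lerDr.
  by move=> /le_trans; apply; nra.
have E0 : 0 <= E.
  by rewrite -lee_fin; apply: le_trans vE; exact: energy_ge0.
have mL : measurable (`](- lam), lam[%classic : set R) by exact: measurable_itv.
have c0 : 0 <= c.
  have /andP[b0 b3] := hb.
  by rewrite mulr_ge0// divr_ge0 ?expR_ge0// le_min ltW//= subr_ge0 ltW.
have F0 := b_flux_ge0 hb mv mw vE.
have mF := measurable_b_flux hb mv mw vE.
have FE := integral_b_flux_le hb mv mw vE.
have FK : ((c * d)%:E <= \int[mu]_(x in `](- lam)%R, lam[) (b_flux b v x)%:E)%E.
  apply: le_trans (integral_b_flux_ge hb mv mw vE lam1).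
  rewrite EFinM lee_wpmul2l ?lee_fin//; apply: (le_trans vd).
  apply: ge0_subset_integral => //.
  - exact: measurable_itv.
  - apply/measurable_EFinP; apply: measurable_funTS.
    by apply: measurable_funD; exact: measurable_funX.
  - by move=> x _; rewrite lee_fin addr_ge0 ?sqr_ge0.
  - exact: Lambda_subset.
have [iv vb] := momentum_bound lam s0 mv (energy_square_le mv mw vE).
have [iF Fl Fu] := flux_bound lam0 lame mF F0 FE FK.
have IE : I = dtheta (s ^+ 3) t * \int[mu]_x (v x * Phi lam (s ^+ 2) x)
    + theta (s ^+ 3) t * \int[mu]_x (b_flux b v x * dPhi lam (s ^+ 2) x).
  rewrite -RintegralZl// -RintegralZl// -RintegralD//; last 2 first.
  - exact: integrable_scale.
  - exact: integrable_scale.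
  by apply: eq_Rintegral => x _; rewrite !derive_testf /=; ring.
rewrite IE; set a := \int[mu]_x _ in vb *; set B := \int[mu]_x _ in Fl Fu *.
have D1 := dtheta_le t s3.
have D2 : `|dtheta (s ^+ 3) t * a| <= (E + 4) / s ^+ 2.
  (* The slope [2 / s^3] of [theta] times the momentum bound [s * (E / 2 + 2)] is exactly
     [(E + 4) / s^2]. *)
  rewrite normrM; apply: (@le_trans _ _ (2 / s ^+ 3 * (s * (E / 2 + 2)))).
    by rewrite ler_pM.
  by rewrite le_eqVlt; apply/orP; left; apply/eqP; field; rewrite gt_eqF.
have th0 := theta_ge0 (s ^+ 3) t; have th1 := theta_le1 (s ^+ 3) t.
move: D2; rewrite ler_norml => /andP[D2 D3].
have Q0 : 0 <= (2 / lam + 2 / s ^+ 2) * (2 * E).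
  by rewrite mulr_ge0 ?addr_ge0 ?divr_ge0 ?mulr_ge0// ltW.
have T1 : theta (s ^+ 3) t * beta <= theta (s ^+ 3) t * B by rewrite ler_wpM2l.
have T2 : theta (s ^+ 3) t * B <= (2 / lam + 2 / s ^+ 2) * (2 * E).
  apply: (@le_trans _ _ (theta (s ^+ 3) t * ((2 / lam + 2 / s ^+ 2) * (2 * E)))).
    by rewrite ler_wpM2l.
  by rewrite -[leRHS]mul1r ler_wpM2r.
by split; lra.
Qed.

(** After multiplication by [s^2] the gain grows linearly in [ln s] while every loss stays constant,
    so a lower bound [d] valid for all late times fails for large [s]. *)
Lemma H1_norm_Lambda_lt (b : R) (u : R -> R -> R) (d T0 : R) :
  0 < b < 3 -> (forall t, 0 <= t -> H1 (u t)) -> ess_bounded_in_H1 u ->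
  b_family_weak_solution b u -> 0 < d ->
  ~ (forall t, T0 < t -> (d%:E <= H1_norm (Lambda (2 / 3) t) (u t))%E).
Proof.
move=> hb uH [M uM] hu d0 ud.
pose E := M ^+ 2.
have E0 : 0 <= E by exact: sqr_ge0.
pose c := expR (-1) / 2 * (Num.min b (3 - b) / 2).
pose k : R := bump 0 1 ^+ 3 / 9.
pose m : R := bump 0 (4^-1) ^+ 2.
have c0 : 0 < c.
  have /andP[b0 b3] := hb.
  by rewrite mulr_gt0// divr_gt0 ?expR_gt0// lt_min b0 subr_gt0.
have k0 : 0 < k by rewrite divr_gt0// exprn_gt0// bump_gt0.
have m0 : 0 < m by rewrite exprn_gt0// bump_gt0.
have K0 : 0 < k * (c * d ^+ 2) / 4
  by rewrite divr_gt0 // (mulr_gt0 k0) // (mulr_gt0 c0) // exprn_gt0.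
(* [L] is the value of [ln s]. The 4 gives [lam <= eta], [|T0|] puts the window after [T0], and the
   quotient makes the gain win; the final [+ 1] makes that strict. *)
pose L := 4 + `|T0| + (4 * E + 2 * (E + 4) / m + 1) / (k * (c * d ^+ 2) / 4).
pose s := expR L.
have Q0 : 0 <= 4 * E + 2 * (E + 4) / m + 1.
  have h1 : 0 <= 4 * E by rewrite mulr_ge0.
  have h2 : 0 <= 2 * (E + 4) / m.
    by apply: divr_ge0; [rewrite mulr_ge0// addr_ge0 | exact: ltW].
  by rewrite !addr_ge0.
have L4 : 4 <= L.
  by rewrite /L -addrA lerDl addr_ge0// divr_ge0// ltW.
have LT : T0 < L.
  rewrite (le_lt_trans (ler_norm _))// /L -addrA addrCA ltrDl.
  by rewrite ltr_pwDl// divr_ge0// ltW.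
have sL : 1 + L <= s by exact: expR_ge1Dx.
have s1 : 1 < s by lra.
have s0 : 0 < s by lra.
have ls : ln s = L by rewrite /s expRK.
have s2 : 0 < s ^+ 2 by rewrite exprn_gt0.
have s3 : 0 < s ^+ 3 by rewrite exprn_gt0.
have sT : T0 < s ^+ 3.
  apply: (@lt_le_trans _ _ s); first by lra.
  by rewrite ler_eXnr// ltW.
pose lam := 4 * s ^+ 2 / ln s.
pose phi := testf (s ^+ 3) lam (s ^+ 2).
pose beta := k / lam * (c * d ^+ 2) - 2 / s ^+ 2 * (2 * E).
have lamE : lam = 4 * s ^+ 2 / L by rewrite /lam ls.
have betaE : beta * s ^+ 2 = k * (c * d ^+ 2) / 4 * L - 4 * E.
  by rewrite /beta lamE; field; rewrite !gt_eqF//; lra.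
have LK : 4 * E + 2 * (E + 4) / m + 1 <= k * (c * d ^+ 2) / 4 * L.
  rewrite [leRHS]mulrC -ler_pdivrMr// /L lerDr addr_ge0//.
have beta_gt : 2 * (E + 4) / m < beta * s ^+ 2 by rewrite betaE; lra.
(* The sign lets [theta * beta] be bounded below by 0 off the middle half of the window and by
   [m * beta] on it. *)
have beta0 : 0 <= beta.
  rewrite -(pmulr_lge0 _ s2) (le_trans _ (ltW beta_gt))//.
  by apply: divr_ge0; [rewrite mulr_ge0// addr_ge0 | exact: ltW].
have phit : test_function [set p : R^o * R^o | 0 < p.1] phi by exact: testf_test.
have := zero_Rintegral_bound s3 (hu phi phit) (A := (E + 4) / s ^+ 2)
  (B := m * beta) (C := (2 / lam + 2 / s ^+ 2) * (2 * E) + (E + 4) / s ^+ 2).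
have H : {ae mu, forall t, 0 < t ->
    m * beta * \1_(`[5 / 4 * s ^+ 3, 7 / 4 * s ^+ 3]) t
      - (E + 4) / s ^+ 2 * \1_(`[s ^+ 3, 2 * s ^+ 3]) t
    <= \int[mu]_x (u t x * 'D_(1, 0) phi (t, x) +
                   b_flux b (u t) x * 'D_(0, 1) phi (t, x))
    <= ((2 / lam + 2 / s ^+ 2) * (2 * E) + (E + 4) / s ^+ 2)
        * \1_(`[s ^+ 3, 2 * s ^+ 3]) t}.
  apply: negligibleS uM => t /=; apply: contra_not => ut t0.
  have vE := H1_norm_le (ut (ltW t0)).
  have [tI|tI] := boolP (s ^+ 3 <= t <= 2 * s ^+ 3).
    have tT : T0 < t by have /andP[h _] := tI; exact: lt_le_trans h.
    have vd := H1_norm_ge (ltW d0) (ud _ tT).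
    have l4 : 4 <= ln s by rewrite ls.
    have := slice_bound hb (uH _ (ltW t0)) vE s1 l4 tI vd.
    rewrite -/E -/c -/lam -/phi -/k -/beta => -[h1 h2].
    rewrite [\1_(`[s ^+ 3, _]%classic) _]indicE mem_set ?mulr1 ?h2 ?andbT//=.
    apply: le_trans h1; rewrite lerD2r indicE.
    have [tJ|_] := boolP (t \in _); last by rewrite mulr0 mulr_ge0 ?theta_ge0.
    by rewrite mulr1 ler_wpM2r// theta_ge//; move: tJ; rewrite inE /= in_itv.
  have tI' : ~ (s ^+ 3 <= t <= 2 * s ^+ 3) by exact/negP.
  rewrite [\1_(`[s ^+ 3, _]%classic) _]indicE memNset ?mulr0; last by rewrite /= in_itv.
  rewrite [\1_(`[5 / 4 * s ^+ 3, _]%classic) _]indicE memNset; last first.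
    rewrite /= in_itv /= => /andP[h1 h2]; apply: tI'; apply/andP; split; lra.
  (* Off the window both [theta] and [dtheta] vanish, so the slice is 0. *)
  have -> : \int[mu]_x (u t x * 'D_(1, 0) phi (t, x) +
                        b_flux b (u t) x * 'D_(0, 1) phi (t, x)) = 0.
    rewrite (@eq_Rintegral _ _ _ _ _ (fun=> 0)) => [|x _]; last first.
      by rewrite !derive_testf /= theta_out// dtheta_out// !(mul0r, mulr0, addr0).
    by rewrite /Rintegral integral0.
  by rewrite mulr0 subr0 lexx.
move=> /(_ H); rewrite ler_pdivlMr//.
have -> : m * beta / 2 * s ^+ 2 = m / 2 * (beta * s ^+ 2) by ring.
apply/negP; rewrite -ltNge.
have -> : E + 4 = m / 2 * (2 * (E + 4) / m) by field; rewrite gt_eqF.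
by rewrite ltr_pM2l// divr_gt0.
Qed.

End Virial.

Unset Implicit Arguments.
Set Strict Implicit.

Theorem theorem1p3 (R : realType) (b : R) (hb : 0 < b < 3) (u : R -> R -> R)
    (hC : continuous_in_H1 u) (hB : ess_bounded_in_H1 u)
    (hu : b_family_weak_solution b u) :
  limf_einf (fun t : R => H1_norm (Lambda (2 / 3) t) (u t)) (pinfty_nbhs R)
    = 0%E.
Proof.
have [uH _] := hC.
rewrite limf_einfE; apply/eqP; rewrite eq_le; apply/andP; split.
  apply: ge_ereal_sup => _ [V [T0 [_ TV]] <-].
  rewrite leNgt; apply/negP => h.
  (* The infimum may be [+oo], in which case [d = 1] serves. *)
  have [d d0 dV] : exists2 d : R, 0 < d &
      (d%:E <= ereal_inf [set H1_norm (Lambda (2 / 3) t) (u t) | t in V])%E.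
    move: h; case: ereal_inf => [r||]//; first by rewrite lte_fin; exists r.
    by move=> _; exists 1; rewrite ?leey.
  apply: (H1_norm_Lambda_lt hb uH hB hu d0 (T0 := T0)) => t tT.
  by apply: (le_trans dV); apply: ereal_inf_lbound; exists t => //; exact: TV.
(* For the other inequality, the whole line is a member of the filter and norms are nonnegative. *)
apply: (@le_trans _ _ (ereal_inf [set H1_norm (Lambda (2 / 3) t) (u t) | t in setT])).
  by apply: le_ereal_inf_tmp => _ [t _ <-]; exact: H1_norm_ge0.
apply: ereal_sup_ubound; exists setT => //; exact: filterT.
Qed.
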